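(* Let $R$ be a discrete valuation ring with uniformizer $\pi$, residue field $\mathbb{F}=R/\pi$, and let $d,d':C^0(G;\mathcal{F})\to C^1(G;\mathcal{F})$ be coboundary operators (on the same cochain modules, with finite-rank free stalks over $R$, over a finite graph $G$) with Smith normal form exponent multisets $\{a_j(d)\}$ and $\{a_j(d')\}$ respectively. If $$d\equiv d'\pmod{\pi^m}$$ for some $m\ge 1$, then for every $k<m$ ($k\geq 0$) the digit connecting maps coincide: $$\partial_k(d)=\partial_k(d')\quad\text{as maps}\quad H^0(G;\mathcal{F}/\pi^k\mathcal{F})\longrightarrow H^1(G;\mathcal{F}/\pi\mathcal{F}),$$ hence $d_k(d)=d_k(d')$ for all $k<m$, where $d_k(\cdot):=\dim_{\mathbb{F}}\mathrm{im}\,\partial_k(\cdot)$. Consequently, the multiplicities of all bar lengths $\ell<m$ coincide: $$\#\{j: a_j(d)=\ell\}=\#\{j: a_j(d')=\ell\}\quad\text{for all } 1\le\ell<m.$$ Equivalently, the truncated barcodes $$\mathrm{Bar}^1_\pi(d)\cap[0,m)=\mathrm{Bar}^1_\pi(d')\cap[0,m)$$ are identical as multisets of intervals, and the truncated valuation persistence modules $\{V^1_k(d)\}_{0\le k<m}$ and $\{V^1_k(d')\}_{0\le k<m}$ are isomorphic.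
   Context: A network sheaf $\mathcal{F}$ of $R$-modules on a finite graph $G=(V,E)$ assigns an $R$-module to each vertex and each edge (the stalks) and an $R$-linear restriction map $\mathcal{F}_{v\to e}:\mathcal{F}(v)\to\mathcal{F}(e)$ to each incidence of a vertex $v$ with an edge $e$. $C^0(G;\mathcal{F})=\prod_v\mathcal{F}(v)$, $C^1(G;\mathcal{F})=\prod_e\mathcal{F}(e)$, and, fixing edge orientations, the coboundary is $(ds)(e)=\mathcal{F}_{u\to e}(s(u))-\mathcal{F}_{v\to e}(s(v))$ for $e:u\to v$. $H^0=\ker d$, $H^1=C^1/\mathrm{im}\,d$; $d$ and $d'$ correspond to two choices of restriction maps on the same stalks, and objects written with $(d)$, resp. $(d')$, are computed from $d$, resp. $d'$. Cohomology of $\mathcal{F}/\pi^k\mathcal{F}$ is that of the two-term complex $C^0/\pi^k\to C^1/\pi^k$ induced by the coboundary. Smith exponents: for suitable invertible matrices $U,V$ over $R$, $U[d]V=\mathrm{diag}(\pi^{a_1},\ldots,\pi^{a_r},0,\ldots,0)$ with $0\le a_1\le\cdots\le a_r$, $r=\mathrm{rank}(d)$. Digit map: $\partial_k$ is the connecting homomorphism $H^0(G;\mathcal{F}/\pi^k\mathcal{F})\to H^1(G;\pi^k\mathcal{F}/\pi^{k+1}\mathcal{F})$ of $0\to\pi^k\mathcal{F}/\pi^{k+1}\mathcal{F}\to\mathcal{F}/\pi^{k+1}\mathcal{F}\to\mathcal{F}/\pi^k\mathcal{F}\to0$, followed by the isomorphism $H^1(G;\pi^k\mathcal{F}/\pi^{k+1}\mathcal{F})\cong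 H^1(G;\mathcal{F}/\pi\mathcal{F})$ induced by $[\pi^kx]\mapsto[x]$. Barcode: if $H^1\cong R^b\oplus\bigoplus_j R/\pi^{a_j}$ with all $a_j\geq 1$, then $\mathrm{Bar}^1_\pi$ is the multiset consisting of $b$ copies of $[0,\infty)$ and the intervals $[0,a_j)$. $\mathrm{Bar}^1_\pi\cap[0,m)$ is the multiset of intersections $I\cap[0,m)$ for $I\in\mathrm{Bar}^1_\pi$. Valuation persistence module: $V^1_k=\pi^kH^1/\pi^{k+1}H^1$, with maps $V^1_k\to V^1_{k+1}$, $[x]\mapsto[\pi x]$; an isomorphism of truncated modules is a family of $\mathbb{F}$-linear isomorphisms for $0\le k<m$ commuting with these maps. *)

(* Defs.v *)
From HB Require Import structures.
From mathcomp Require Import all_boot all_order all_algebra.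
From mathcomp Require Import boolp.

Set Implicit Arguments.
Unset Strict Implicit.
Unset Printing Implicit Defensive.

Import Order.TTheory GRing.Theory.
Local Open Scope ring_scope.
Local Open Scope quotient_scope.

(* Submodules are the library's [submodClosed]; subquotients are built from
   subtypes and from the quotients [{ideal_quot N}] of ring_quotient.v (which,
   despite the notation, accept any subgroup N). *)

Section Submodules.
Variable R : comNzRingType.
Implicit Types M N : lmodType R.

Definition kerm M N (f : {linear M -> N}) : {pred M} := fun x => f x == 0.

Definition imgm M N (f : {linear M -> N}) : {pred N} :=
  fun y => `[< exists x, y = f x >].

(* r M *)
Definition mults (r : R) M : {pred M} := fun y => `[< exists x, y = r *: x >].
Arguments mults : clear implicits.

Lemma kermE M N (f : {linear M -> N}) x : (x \in kerm f) = (f x == 0).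
Proof. by []. Qed.

Lemma imgmP M N (f : {linear M -> N}) y :
  reflect (exists x, y = f x) (y \in imgm f).
Proof. exact: asboolP. Qed.

Lemma multsP (r : R) M (y : M) :
  reflect (exists x, y = r *: x) (y \in mults r M).
Proof. exact: asboolP. Qed.

Lemma kerm_closed M N (f : {linear M -> N}) : submod_closed (kerm f).
Proof.
split=> [|a x y]; rewrite !kermE ?linear0//.
by rewrite linearP => /eqP-> /eqP->; rewrite scaler0 addr0.
Qed.

Lemma imgm_closed M N (f : {linear M -> N}) : submod_closed (imgm f).
Proof.
split=> [|a x y]; first by apply/imgmP; exists 0; rewrite linear0.
move=> /imgmP[u ->] /imgmP[v ->]; apply/imgmP; exists (a *: u + v).
by rewrite linearP.
Qed.

Lemma mults_closed (r : R) M : submod_closed (mults r M).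
Proof.
split=> [|a x y]; first by apply/multsP; exists 0; rewrite scaler0.
move=> /multsP[u ->] /multsP[v ->]; apply/multsP; exists (a *: u + v).
by rewrite scalerDr !scalerA mulrC.
Qed.

HB.instance Definition _ M N (f : {linear M -> N}) :=
  GRing.isSubmodClosed.Build R M (kerm f) (kerm_closed f).
HB.instance Definition _ M N (f : {linear M -> N}) :=
  GRing.isSubmodClosed.Build R N (imgm f) (imgm_closed f).
HB.instance Definition _ (r : R) M :=
  GRing.isSubmodClosed.Build R M (mults r M) (mults_closed r M).

Definition submodule M (N : submodClosed M) : Type := {x : M | x \in N}.
HB.instance Definition _ M (N : submodClosed M) := SubChoice.on (submodule N).
HB.instance Definition _ M (N : submodClosed M) :=
  [SubChoice_isSubLmodule of submodule N by <:].

(* N, seen inside the submodule L *)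
Definition within M (L N : submodClosed M) : {pred submodule L} :=
  fun x => val x \in N.
Arguments within [M] L N : rename.

Lemma withinE M (L N : submodClosed M) (x : submodule L) :
  (x \in within L N) = (val x \in N).
Proof. by []. Qed.

Lemma within_closed M (L N : submodClosed M) : submod_closed (within L N).
Proof.
split=> [|a x y]; rewrite !withinE ?rpred0// linearP /=.
by move=> hx hy; rewrite rpredD ?rpredZ.
Qed.

HB.instance Definition _ M (L N : submodClosed M) :=
  GRing.isSubmodClosed.Build R (submodule L) (within L N) (within_closed L N).

End Submodules.
Arguments mults {R} r M _ : simpl never.
Arguments within {R M} L N _ : simpl never.
Arguments kerm {R M N} f _ : simpl never.
Arguments imgm {R M N} f _ : simpl never.

Section QuotientModule.
Variables (R : comNzRingType) (M : lmodType R) (N : submodClosed M).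

Fact submod_oppr_closed : oppr_closed (N : {pred M}).
Proof. by move=> x Nx; rewrite -scaleN1r rpredZ. Qed.

Definition subgroup_of_submod : zmodClosed M :=
  HB.pack (GRing.SubmodClosed.sort N)
    (GRing.isOppClosed.Build M (GRing.SubmodClosed.sort N) submod_oppr_closed).

(* M / N *)
Definition quotmod : Type := {ideal_quot subgroup_of_submod}.
HB.instance Definition _ := ZmodQuotient.on quotmod.

Definition cls (x : M) : quotmod := \pi_quotmod x.

Lemma cls_surj z : exists x, z = cls x.
Proof. by exists (repr z); rewrite /cls reprK. Qed.

Lemma cls_repr z : cls (repr z) = z. Proof. by rewrite /cls reprK. Qed.

Lemma cls_eq (x y : M) : (cls x = cls y) <-> (x - y \in N).
Proof.
have <- : (x - y \in subgroup_of_submod) = (x - y \in N) by [].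
by rewrite Quotient.idealrBE; split=> [xy|/eqP]; first exact/eqP.
Qed.

Lemma clsD x y : cls (x + y) = cls x + cls y. Proof. exact: raddfD. Qed.

Definition quotmod_scale (a : R) (x : quotmod) : quotmod := cls (a *: repr x).

Lemma scale_cls a x : quotmod_scale a (cls x) = cls (a *: x).
Proof. by apply/cls_eq; rewrite -scalerBr rpredZ//; apply/cls_eq/cls_repr. Qed.

Fact quotmod_scaleA a b x :
  quotmod_scale a (quotmod_scale b x) = quotmod_scale (a * b) x.
Proof. by have [u ->] := cls_surj x; rewrite !scale_cls scalerA. Qed.
Fact quotmod_scale1 : left_id 1 quotmod_scale.
Proof. by move=> x; have [u ->] := cls_surj x; rewrite !scale_cls scale1r. Qed.
Fact quotmod_scaleDr : right_distributive quotmod_scale +%R.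
Proof.
move=> a x y; have [u ->] := cls_surj x; have [v ->] := cls_surj y.
by rewrite -clsD !scale_cls scalerDr clsD.
Qed.
Fact quotmod_scaleDl x : {morph quotmod_scale^~ x : a b / a + b}.
Proof.
by move=> a b; have [u ->] := cls_surj x; rewrite !scale_cls scalerDl clsD.
Qed.

HB.instance Definition _ := GRing.Zmodule_isLmodule.Build R quotmod
  quotmod_scaleA quotmod_scale1 quotmod_scaleDr quotmod_scaleDl.

Fact cls_is_linear : linear cls.
Proof. by move=> a x y; rewrite clsD -scale_cls. Qed.
HB.instance Definition _ :=
  GRing.isLinear.Build R M quotmod *:%R cls cls_is_linear.

End QuotientModule.
Arguments cls {R M} N x.

Section InducedMaps.
Variable R : comNzRingType.
Implicit Types M : lmodType R.

Definition quotmap M M' (N : submodClosed M) (N' : submodClosed M')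
    (f : {linear M -> M'}) (fN : forall x, x \in N -> f x \in N')
    (x : quotmod N) : quotmod N' :=
  cls N' (f (repr x)).

Definition submap M M' (N : submodClosed M) (N' : submodClosed M')
    (f : {linear M -> M'}) (fN : forall x, x \in N -> f x \in N')
    (x : submodule N) : submodule N' :=
  Sub (f (val x)) (fN (val x) (valP x)).

Lemma quotmapE M M' (N : submodClosed M) (N' : submodClosed M')
    (f : {linear M -> M'}) fN x : @quotmap _ _ N N' f fN (cls N x) = cls N' (f x).
Proof. by apply/cls_eq; rewrite -linearB fN//; apply/cls_eq; rewrite /cls reprK. Qed.

Fact quotmap_is_linear M M' (N : submodClosed M) (N' : submodClosed M')
  (f : {linear M -> M'}) fN : linear (@quotmap _ _ N N' f fN).
Proof.
move=> a x y; have [u ->] := cls_surj x; have [v ->] := cls_surj y.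
by rewrite -linearP !quotmapE !linearP.
Qed.
HB.instance Definition _ M M' (N : submodClosed M) (N' : submodClosed M') f fN :=
  GRing.isLinear.Build R (quotmod N) (quotmod N') *:%R (@quotmap _ _ N N' f fN)
    (@quotmap_is_linear _ _ N N' f fN).

Fact submap_is_linear M M' (N : submodClosed M) (N' : submodClosed M')
  (f : {linear M -> M'}) fN : linear (@submap _ _ N N' f fN).
Proof. by move=> a x y; apply: val_inj; rewrite /= !linearP. Qed.
HB.instance Definition _ M M' (N : submodClosed M) (N' : submodClosed M') f fN :=
  GRing.isLinear.Build R (submodule N) (submodule N') *:%R (@submap _ _ N N' f fN)
    (@submap_is_linear _ _ N N' f fN).

End InducedMaps.

Section Complexes.
Variable R : comNzRingType.

Record cplx := Cplx {
  cplx0 : lmodType R;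
  cplx1 : lmodType R;
  diff :> {linear cplx0 -> cplx1} }.

Definition H0 (K : cplx) := submodule (kerm (diff K)).
Definition H1 (K : cplx) := quotmod (imgm (diff K)).
HB.instance Definition _ K := GRing.Lmodule.on (H0 K).
HB.instance Definition _ K := GRing.Lmodule.on (H1 K).

Record cplx_map (K L : cplx) := CplxMap {
  map0 : {linear cplx0 K -> cplx0 L};
  map1 : {linear cplx1 K -> cplx1 L};
  map_comm : forall x, map1 (diff K x) = diff L (map0 x) }.

Fact map1_img K L (f : cplx_map K L) y :
  y \in imgm (diff K) -> map1 f y \in imgm (diff L).
Proof. by move=> /imgmP[x ->]; apply/imgmP; exists (map0 f x); rewrite map_comm. Qed.

Definition H1map K L (f : cplx_map K L) : {linear H1 K -> H1 L} :=
  quotmap (map1_img f).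

Lemma H1mapE K L (f : cplx_map K L) y : H1map f (cls _ y) = cls _ (map1 f y).
Proof. exact: quotmapE. Qed.

Record short_exact K' K K'' (i : cplx_map K' K) (p : cplx_map K K'') : Prop := {
  se_inj0 : injective (map0 i);
  se_inj1 : injective (map1 i);
  se_mid0 : forall x, map0 p x = 0 <-> exists x', x = map0 i x';
  se_mid1 : forall y, map1 p y = 0 <-> exists y', y = map1 i y';
  se_surj0 : forall z, exists x, z = map0 p x;
  se_surj1 : forall z, exists y, z = map1 p y }.

Section Connecting.
Variables (K' K K'' : cplx) (i : cplx_map K' K) (p : cplx_map K K'').
Hypothesis exact_ip : short_exact i p.

Fact connecting_subproof (z : H0 K'') : exists y' : cplx1 K',
  exists2 x, map0 p x = val z & diff K x = map1 i y'.
Proof.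
have [x zE] := se_surj0 exact_ip (val z).
have /(se_mid1 exact_ip)[y' y'E] : map1 p (diff K x) = 0.
  by rewrite map_comm -zE; apply/eqP; exact: (valP z).
by exists y', x.
Qed.

(* Lift a cocycle of K'' to K, apply the differential, pull back to K'. *)
Definition connecting (z : H0 K'') : H1 K' :=
  cls _ (projT1 (cid (connecting_subproof z))).

Lemma connectingE z x y' :
  map0 p x = val z -> diff K x = map1 i y' -> connecting z = cls _ y'.
Proof.
move=> xz xy; rewrite /connecting; case: cid => /= t [u uz ut]; apply/cls_eq.
have /(se_mid0 exact_ip)[x' x'E] : map0 p (u - x) = 0.
  by rewrite linearB /= uz xz subrr.
apply/imgmP; exists x'; apply: (se_inj1 exact_ip).
by rewrite map_comm -x'E !linearB /= -ut -xy.
Qed.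

Fact connecting_is_linear : linear connecting.
Proof.
move=> a z1 z2; have [y1 [x1 p1 d1]] := connecting_subproof z1.
have [y2 [x2 p2 d2]] := connecting_subproof z2.
rewrite (connectingE p1 d1) (connectingE p2 d2) -linearP.
by apply: (@connectingE _ (a *: x1 + x2)); rewrite !linearP ?p1 ?p2 ?d1 ?d2.
Qed.
HB.instance Definition _ :=
  GRing.isLinear.Build R (H0 K'') (H1 K') *:%R connecting connecting_is_linear.

End Connecting.

End Complexes.

Section InverseMap.
Variables (R : comNzRingType) (M N : lmodType R) (f : {linear M -> N}).
Hypothesis bij_f : bijective f.

Fact linv_subproof y : exists x, y = f x.
Proof. by have [g _ gK] := bij_f; exists (g y). Qed.

Definition linv (y : N) : M := projT1 (cid (linv_subproof y)).

Lemma linvK : cancel linv f.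
Proof. by move=> y; rewrite /linv; case: cid. Qed.

Fact linv_is_linear : linear linv.
Proof. by move=> a x y; apply: (bij_inj bij_f); rewrite linearP !linvK. Qed.
HB.instance Definition _ :=
  GRing.isLinear.Build R N M *:%R linv linv_is_linear.

End InverseMap.

Section Reduction.
Variables (R : comNzRingType) (pi : R).
Implicit Types (M : lmodType R) (K : cplx R) (k : nat).

(* M / pi^k M *)
Definition redmod M k := quotmod (mults (pi ^+ k) M).
HB.instance Definition _ M k := GRing.Lmodule.on (redmod M k).

(* pi^k M / pi^(k+1) M *)
Definition grmod M k :=
  quotmod (within (mults (pi ^+ k) M) (mults (pi ^+ k.+1) M)).
HB.instance Definition _ M k := GRing.Lmodule.on (grmod M k).

Fact mults_map r M M' (f : {linear M -> M'}) x :
  x \in mults r M -> f x \in mults r M'.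
Proof. by move=> /multsP[u ->]; apply/multsP; exists (f u); rewrite linearZ. Qed.

Fact mults_le M k x : x \in mults (pi ^+ k.+1) M -> x \in mults (pi ^+ k) M.
Proof.
by move=> /multsP[u ->]; apply/multsP; exists (pi *: u); rewrite scalerA -exprSr.
Qed.

Definition redmap M M' (f : {linear M -> M'}) k :
  {linear redmod M k -> redmod M' k} := quotmap (@mults_map (pi ^+ k) _ _ f).

Definition submults r M M' (f : {linear M -> M'}) :
  {linear submodule (mults r M) -> submodule (mults r M')} :=
  submap (@mults_map r _ _ f).

Fact grmap_subproof M M' (f : {linear M -> M'}) k x :
  x \in within (mults (pi ^+ k) M) (mults (pi ^+ k.+1) M) ->
  submults (pi ^+ k) f x \in within (mults (pi ^+ k) M') (mults (pi ^+ k.+1) M').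
Proof. exact: mults_map. Qed.

Definition grmap M M' (f : {linear M -> M'}) k :
  {linear grmod M k -> grmod M' k} := quotmap (@grmap_subproof _ _ f k).

Lemma redmapE M M' (f : {linear M -> M'}) k x :
  redmap f k (cls _ x) = cls _ (f x).
Proof. exact: quotmapE. Qed.

Lemma grmapE M M' (f : {linear M -> M'}) k x :
  grmap f k (cls _ x) = cls _ (submults (pi ^+ k) f x).
Proof. exact: quotmapE. Qed.

(* K / pi^k K *)
Definition redc K k : cplx R := Cplx (redmap (diff K) k).
(* pi^k K / pi^(k+1) K *)
Definition grc K k : cplx R := Cplx (grmap (diff K) k).

Section GradedInclusion.
Variables (M : lmodType R) (k : nat).
Let val_lin : {linear submodule (mults (pi ^+ k) M) -> M} := val.

Definition gr_incl : {linear grmod M k -> redmod M k.+1} :=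
  quotmap (f := val_lin) (fun x (h : x \in within _ _) => h).

Definition red_proj : {linear redmod M k.+1 -> redmod M k} :=
  quotmap (f := idfun) (@mults_le M k).

(* x |-> pi^k x *)
Definition scale_into (x : M) : submodule (mults (pi ^+ k) M) :=
  Sub (pi ^+ k *: x) (introT (multsP _ _) (ex_intro _ x erefl)).

Fact scale_into_is_linear : linear scale_into.
Proof.
by move=> a x y; apply: val_inj; rewrite /= scalerDr !scalerA mulrC.
Qed.
HB.instance Definition _ := GRing.isLinear.Build R M
  (submodule (mults (pi ^+ k) M)) *:%R scale_into scale_into_is_linear.

Fact gr_shift_subproof x : x \in mults (pi ^+ 1) M ->
  scale_into x \in within (mults (pi ^+ k) M) (mults (pi ^+ k.+1) M).
Proof.
move=> /multsP[u ->]; apply/multsP; exists u.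
by rewrite /= scalerA -exprD addn1.
Qed.

(* [x] |-> [pi^k x] *)
Definition gr_shift : {linear redmod M 1 -> grmod M k} :=
  quotmap gr_shift_subproof.

Lemma gr_inclE x : gr_incl (cls _ x) = cls _ (val x).
Proof. exact: quotmapE. Qed.
Lemma red_projE x : red_proj (cls _ x) = cls _ x.
Proof. exact: quotmapE. Qed.
Lemma gr_shiftE x : gr_shift (cls _ x) = cls _ (scale_into x).
Proof. exact: quotmapE. Qed.

End GradedInclusion.

Section DigitSequence.
Variables (K : cplx R) (k : nat).

Fact gr_incl_comm x :
  gr_incl _ k (grc K k x) = redc K k.+1 (gr_incl _ k x).
Proof. by have [u ->] := cls_surj x; rewrite /= grmapE !gr_inclE redmapE. Qed.
Definition gr_inclc : cplx_map (grc K k) (redc K k.+1) :=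
  @CplxMap R (grc K k) (redc K k.+1) (gr_incl _ k) (gr_incl _ k) gr_incl_comm.

Fact red_proj_comm x :
  red_proj _ k (redc K k.+1 x) = redc K k (red_proj _ k x).
Proof. by have [u ->] := cls_surj x; rewrite /= redmapE !red_projE redmapE. Qed.
Definition red_projc : cplx_map (redc K k.+1) (redc K k) :=
  @CplxMap R (redc K k.+1) (redc K k) (red_proj _ k) (red_proj _ k) red_proj_comm.

Fact gr_shift_comm x :
  gr_shift _ k (redc K 1 x) = grc K k (gr_shift _ k x).
Proof.
have [u ->] := cls_surj x; rewrite /= redmapE !gr_shiftE grmapE; congr cls.
by apply: val_inj; rewrite /= linearZ.
Qed.
Definition gr_shiftc : cplx_map (redc K 1) (grc K k) :=
  @CplxMap R (redc K 1) (grc K k) (gr_shift _ k) (gr_shift _ k) gr_shift_comm.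

Fact gr_incl_inj M : injective (gr_incl M k).
Proof.
move=> x y; have [u ->] := cls_surj x; have [v ->] := cls_surj y.
by rewrite !gr_inclE => /cls_eq uv; apply/cls_eq.
Qed.

Fact red_proj_surj M z : exists x, z = red_proj M k x.
Proof. by have [u ->] := cls_surj z; exists (cls _ u); rewrite red_projE. Qed.

Fact gr_red_mid M x : red_proj M k x = 0 <-> exists x', x = gr_incl M k x'.
Proof.
have [u ->] := cls_surj x; split=> [|[y ->]].
  rewrite red_projE -[0](linear0 (cls (mults (pi ^+ k) M))) => /cls_eq.
  rewrite subr0 => uP; exists (cls _ (Sub u uP)); by rewrite gr_inclE.
have [v ->] := cls_surj y; rewrite gr_inclE red_projE -[0](linear0 (cls (mults _ M))).
by apply/cls_eq; rewrite subr0; exact: (valP v).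
Qed.

(* 0 -> pi^k K / pi^(k+1) K -> K / pi^(k+1) K -> K / pi^k K -> 0 *)
Lemma digit_sequence : short_exact gr_inclc red_projc.
Proof.
by split; [exact: gr_incl_inj | exact: gr_incl_inj | exact: gr_red_mid
          | exact: gr_red_mid | exact: red_proj_surj | exact: red_proj_surj].
Qed.

Hypothesis pi_reg : forall (n : nat) (x : cplx1 K), pi ^+ n *: x = 0 -> x = 0.

Fact gr_shift_bij : bijective (H1map gr_shiftc).
Proof.
have inj : injective (H1map gr_shiftc).
  move=> x y; have [a ->] := cls_surj x; have [b ->] := cls_surj y.
  have [u ->] := cls_surj a; have [v ->] := cls_surj b.
  rewrite !H1mapE !gr_shiftE => /cls_eq /imgmP[c]; have [w ->] := cls_surj c.
  have /multsP[t tE] := valP w.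
  rewrite -linearB /= grmapE => /cls_eq /multsP[s].
  have dt : diff K (pi ^+ k *: t) = pi ^+ k *: diff K t by exact: linearZ.
  rewrite /= tE dt => usE.
  have /pi_reg/eqP : pi ^+ k *: (u - v - diff K t - pi *: s) = 0.
    by rewrite !scalerBr usE scalerA -exprSr subrr.
  rewrite subr_eq0 => /eqP sE.
  apply/cls_eq/imgmP; exists (cls _ t); rewrite -linearB /= redmapE.
  by apply/cls_eq/multsP; exists s; rewrite expr1.
have surj y : exists x, y = H1map gr_shiftc x.
  have [a ->] := cls_surj y; have [u ->] := cls_surj a.
  have /multsP[v vE] := valP u.
  exists (cls _ (cls _ v)); rewrite H1mapE /= gr_shiftE.
  by congr (cls _ (cls _ _)); apply: val_inj.
by exists (fun y => projT1 (cid (surj y))) => x; case: cid => //= z /inj.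
Qed.

(* The connecting map followed by the inverse of [x] |-> [pi^k x]. *)
Definition digit_of : {linear H0 (redc K k) -> H1 (redc K 1)} :=
  linv gr_shift_bij \o connecting digit_sequence.

End DigitSequence.
End Reduction.

Definition is_ideal (R : comNzRingType) (I : R -> Prop) : Prop :=
  [/\ I 0, forall x y, I x -> I y -> I (x + y) & forall a x, I x -> I (a * x)].

(* Discrete valuation rings: local principal ideal domains that are not fields. *)
HB.mixin Record isDVR R of GRing.IntegralDomain R := {
  principal_ideals : forall I : R -> Prop, is_ideal I ->
    exists a, forall x, I x <-> exists y, x = a * y;
  nonunits_addr : forall x y : R,
    x \isn't a GRing.unit -> y \isn't a GRing.unit ->
    x + y \isn't a GRing.unit;
  exists_nonunit : exists2 x : R, x != 0 & x \isn't a GRing.unit }.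

#[short(type="dvrType")]
HB.structure Definition DVR := {R of GRing.IntegralDomain R & isDVR R}.

(* A generator of the maximal ideal. *)
Record uniformizer (R : dvrType) := Uniformizer {
  uniformizer_val :> R;
  uniformizerP : forall x : R,
    x \isn't a GRing.unit <-> exists y, x = uniformizer_val * y }.

Section ResidueField.
Variables (R : dvrType) (pi : uniformizer R).

Lemma uniformizer_nonunit : (pi : R) \isn't a GRing.unit.
Proof. by apply/(uniformizerP pi); exists 1; rewrite mulr1. Qed.

Lemma uniformizer_neq0 : (pi : R) != 0.
Proof.
have [x x0 /(uniformizerP pi)[y xE]] := @exists_nonunit R.
by apply: contraNneq x0 => pi0; rewrite xE pi0 mul0r.
Qed.

Definition max_ideal : {pred R} := fun x => `[< exists y, x = (pi : R) * y >].

Lemma max_idealE x : (x \in max_ideal) = (x \isn't a GRing.unit).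
Proof. by apply/asboolP/idP => /(uniformizerP pi). Qed.

Lemma max_ideal_idealr : idealr_closed max_ideal.
Proof.
split; rewrite ?max_idealE ?unitr0 ?unitr1// => a x y.
rewrite !max_idealE => /(uniformizerP pi)[u ->] /(uniformizerP pi)[v ->].
by apply/(uniformizerP pi); exists (a * u + v); rewrite mulrDr mulrCA.
Qed.
HB.instance Definition _ := isIdealr.Build R max_ideal max_ideal_idealr.

(* R / pi *)
Definition residue : Type := {ideal_quot max_ideal}.
HB.instance Definition _ := NzRingQuotient.on residue.
HB.instance Definition _ := GRing.ComNzRing.on residue.

Definition residue_inv (x : residue) : residue :=
  if x == 0 then 0 else \pi_residue (repr x)^-1.

Fact residue_mulVf x : x != 0 -> residue_inv x * x = 1.
Proof.
move=> x0; rewrite /residue_inv (negPf x0) -{2}[x]reprK -rmorphM /=.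
rewrite mulVr ?rmorph1//; apply: contraNT x0; rewrite -max_idealE => xI.
by rewrite -[x]reprK -(rmorph0 \pi_residue) -Quotient.idealrBE subr0.
Qed.

Fact residue_inv0 : residue_inv 0 = 0.
Proof. by rewrite /residue_inv eqxx. Qed.

HB.instance Definition _ :=
  GRing.ComNzRing_isField.Build residue residue_mulVf residue_inv0.

(* An R-module killed by pi, as a vector space over the residue field. *)
Definition resmod (M : lmodType R) (piM : forall x : M, (pi : R) *: x = 0) :
  Type := M.

Section ResidueSpace.
Variables (M : lmodType R) (piM : forall x : M, (pi : R) *: x = 0).
Local Notation V := (resmod piM).

HB.instance Definition _ := GRing.Zmodule.on V.

Definition resmod_scale (a : residue) (x : V) : V := repr a *: (x : M).

Lemma resmod_scaleE (r : R) (x : V) :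
  resmod_scale (\pi_residue r) x = r *: (x : M).
Proof.
apply/eqP; rewrite -subr_eq0 -scalerBl.
have : repr (\pi_residue r) - r \in max_ideal.
  by rewrite Quotient.idealrBE reprK.
by move=> /asboolP[y ->]; rewrite mulrC -scalerA piM scaler0.
Qed.

Fact resmod_scaleA a b x :
  resmod_scale a (resmod_scale b x) = resmod_scale (a * b) x.
Proof.
by rewrite -[a]reprK -[b]reprK -rmorphM !resmod_scaleE scalerA.
Qed.
Fact resmod_scale1 : left_id 1 resmod_scale.
Proof. by move=> x; rewrite -(rmorph1 \pi_residue) resmod_scaleE scale1r. Qed.
Fact resmod_scaleDr : right_distributive resmod_scale +%R.
Proof. by move=> a x y; exact: scalerDr. Qed.
Fact resmod_scaleDl x : {morph resmod_scale^~ x : a b / a + b}.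
Proof.
move=> a b; rewrite -[a]reprK -[b]reprK -rmorphD !resmod_scaleE.
exact: scalerDl.
Qed.

HB.instance Definition _ := GRing.Zmodule_isLmodule.Build residue V
  resmod_scaleA resmod_scale1 resmod_scaleDr resmod_scaleDl.

End ResidueSpace.
End ResidueField.

Definition has_dim (F : fieldType) (V : lmodType F) (n : nat) : Prop :=
  exists f : {linear V -> 'rV[F]_n}, bijective f.

Record persmod (F : fieldType) := PersMod {
  pers_space :> nat -> lmodType F;
  pers_step : forall k, {linear pers_space k -> pers_space k.+1} }.

(* Isomorphism of the truncations to 0 <= k < m; the components phi k with
   k >= m are irrelevant. *)
Definition trunc_iso (F : fieldType) (m : nat) (V W : persmod F) : Prop :=
  exists phi : forall k, {linear V k -> W k},
    (forall k, (k < m)%N -> bijective (phi k)) /\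
    (forall k, (k.+1 < m)%N -> forall x,
      phi k.+1 (pers_step V k x) = pers_step W k (phi k x)).

Section Valuation.
Variables (R : dvrType) (pi : uniformizer R) (M : lmodType R).

Fact grmod_killed k (x : grmod (pi : R) M k) : (pi : R) *: x = 0.
Proof.
have [u ->] := cls_surj x; have /multsP[v vE] := valP u.
rewrite -linearZ /= -[0](linear0 (cls _)); apply/cls_eq/multsP; exists v.
by rewrite /= subr0 vE scalerA -exprS.
Qed.

Definition vspace_at k : lmodType (residue pi) := resmod (@grmod_killed k).

Fact valuation_step_subproof k (x : submodule (mults ((pi : R) ^+ k) M)) :
  (pi : R) *: val x \in mults ((pi : R) ^+ k.+1) M.
Proof.
have /multsP[v ->] := valP x; apply/multsP; exists v.
by rewrite scalerA -exprS.
Qed.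

Definition mulpi k (x : submodule (mults ((pi : R) ^+ k) M)) :
    submodule (mults ((pi : R) ^+ k.+1) M) :=
  Sub ((pi : R) *: val x) (valuation_step_subproof x).

Fact mulpi_is_linear k : linear (@mulpi k).
Proof.
by move=> a x y; apply: val_inj; rewrite /= scalerDr !scalerA mulrC.
Qed.
HB.instance Definition _ k := GRing.isLinear.Build R
  (submodule (mults ((pi : R) ^+ k) M)) (submodule (mults ((pi : R) ^+ k.+1) M))
  *:%R (@mulpi k) (@mulpi_is_linear k).

Fact mulpi_within k x :
  x \in within (mults ((pi : R) ^+ k) M) (mults ((pi : R) ^+ k.+1) M) ->
  mulpi x \in within (mults ((pi : R) ^+ k.+1) M) (mults ((pi : R) ^+ k.+2) M).
Proof.
move=> /multsP[v vE]; apply/multsP; exists v.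
by rewrite /= vE scalerA -exprS.
Qed.

(* [x] |-> [pi x] *)
Definition gr_step k : grmod (pi : R) M k -> grmod (pi : R) M k.+1 :=
  quotmap (@mulpi_within k).

Definition vspace_step k : vspace_at k -> vspace_at k.+1 := @gr_step k.

Fact vspace_step_is_linear k : linear (@vspace_step k).
Proof.
by move=> a x y; exact: (quotmap_is_linear (@mulpi_within k) (repr a) x y).
Qed.
HB.instance Definition _ k := GRing.isLinear.Build (residue pi)
  (vspace_at k) (vspace_at k.+1) *:%R (@vspace_step k) (@vspace_step_is_linear k).

Definition valuation_persmod : persmod (residue pi) :=
  PersMod (fun k => @vspace_step k : {linear _ -> _}).

End Valuation.

(* Product of finitely many modules. *)
Section FiniteProduct.
Variables (R : pzRingType) (I : finType) (M : I -> lmodType R).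

Definition prodmod : Type := {dffun forall i, M i}.
HB.instance Definition _ := Choice.on prodmod.
Implicit Types f g : prodmod.

Definition prodmod_of (s : forall i, M i) : prodmod := [ffun i => s i].

Definition prodmod_zero : prodmod := prodmod_of (fun=> 0).
Definition prodmod_opp f := prodmod_of (fun i => - f i).
Definition prodmod_add f g := prodmod_of (fun i => f i + g i).
Definition prodmod_scale (a : R) f := prodmod_of (fun i => a *: f i).

Fact prodmod_addA : associative prodmod_add.
Proof. by move=> f g h; apply/ffunP=> i; rewrite !ffunE addrA. Qed.
Fact prodmod_addC : commutative prodmod_add.
Proof. by move=> f g; apply/ffunP=> i; rewrite !ffunE addrC. Qed.
Fact prodmod_add0 : left_id prodmod_zero prodmod_add.
Proof. by move=> f; apply/ffunP=> i; rewrite !ffunE add0r. Qed.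
Fact prodmod_addN : left_inverse prodmod_zero prodmod_opp prodmod_add.
Proof. by move=> f; apply/ffunP=> i; rewrite !ffunE addNr. Qed.
HB.instance Definition _ := GRing.isZmodule.Build prodmod
  prodmod_addA prodmod_addC prodmod_add0 prodmod_addN.

Fact prodmod_scaleA a b f :
  prodmod_scale a (prodmod_scale b f) = prodmod_scale (a * b) f.
Proof. by apply/ffunP=> i; rewrite !ffunE scalerA. Qed.
Fact prodmod_scale1 : left_id 1 prodmod_scale.
Proof. by move=> f; apply/ffunP=> i; rewrite !ffunE scale1r. Qed.
Fact prodmod_scaleDr : right_distributive prodmod_scale +%R.
Proof. by move=> a f g; apply/ffunP=> i; rewrite !ffunE scalerDr. Qed.
Fact prodmod_scaleDl f : {morph prodmod_scale^~ f : a b / a + b}.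
Proof. by move=> a b; apply/ffunP=> i; rewrite !ffunE scalerDl. Qed.
HB.instance Definition _ := GRing.Zmodule_isLmodule.Build R prodmod
  prodmod_scaleA prodmod_scale1 prodmod_scaleDr prodmod_scaleDl.

Lemma prodmodDE f g i : (f + g) i = f i + g i. Proof. by rewrite ffunE. Qed.
Lemma prodmodZE a f i : (a *: f) i = a *: f i. Proof. by rewrite ffunE. Qed.

End FiniteProduct.

(* A finite graph with a chosen orientation of each edge; parallel edges and
   loops are allowed. *)
Record graph := Graph {
  vert : finType;
  edge : finType;
  src : edge -> vert;
  tgt : edge -> vert }.

(* A [vectType R] is a free module of finite rank over R. *)
Record stalks (R : nzRingType) (G : graph) := Stalks {
  vstalk : vert G -> vectType R;
  estalk : edge G -> vectType R }.

(* One restriction map for each of the two ends of each edge; together with its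
   stalks this is a network sheaf on G. *)
Record restrictions R G (S : stalks R G) := Restrictions {
  rsrc : forall e : edge G, {linear vstalk S (src e) -> estalk S e};
  rtgt : forall e : edge G, {linear vstalk S (tgt e) -> estalk S e} }.

Section Coboundary.
Variables (R : nzRingType) (G : graph) (S : stalks R G).

Definition C0 := prodmod (fun v => vstalk S v : lmodType R).
Definition C1 := prodmod (fun e => estalk S e : lmodType R).
HB.instance Definition _ := GRing.Lmodule.on C0.
HB.instance Definition _ := GRing.Lmodule.on C1.

Variable F : restrictions S.

Definition coboundary_fun (s : C0) : C1 :=
  prodmod_of (fun e => rsrc F e (s (src e)) - rtgt F e (s (tgt e))).

Fact coboundary_is_linear : linear coboundary_fun.
Proof.
move=> a s t; apply/ffunP => e; rewrite !(prodmodDE, prodmodZE, ffunE) /=.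
by rewrite [rsrc F e _]linearP [rtgt F e _]linearP scalerBr opprD addrACA.
Qed.
HB.instance Definition _ :=
  GRing.isLinear.Build R C0 C1 *:%R coboundary_fun coboundary_is_linear.

Definition coboundary : {linear C0 -> C1} := coboundary_fun.

End Coboundary.

Section Digits.
Import VectorInternalTheory.
Variables (R : dvrType) (pi : uniformizer R) (G : graph) (S : stalks R G).
Implicit Types (d : {linear C0 S -> C1 S}) (k n : nat).

Fact C1_regular n (x : C1 S) : (pi : R) ^+ n *: x = 0 -> x = 0.
Proof.
move=> px; apply/ffunP => e; rewrite [RHS]ffunE.
have : (pi : R) ^+ n *: x e = 0 by rewrite -prodmodZE px ffunE.
move=> /(congr1 v2r); rewrite linear0 [LHS]linearZ => /rowP h.
apply: v2r_inj; rewrite linear0; apply/rowP => j.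
have := h j; rewrite !mxE => /eqP.
by rewrite mulf_eq0 expf_eq0 (negPf (uniformizer_neq0 pi)) andbF => /eqP.
Qed.

Definition digit d k :
    {linear H0 (redc (pi : R) (Cplx d) k) -> H1 (redc (pi : R) (Cplx d) 1)} :=
  @digit_of R (pi : R) (Cplx d) k C1_regular.

(* The H0's of the two sides are equal submodules of C0 / pi^k, the H1's are
   equal quotients of C1 / pi, and the two digit maps send every element to the
   same class. *)
Definition same_digit d d' k : Prop :=
  [/\ kerm (redc (pi : R) (Cplx d) k) =i kerm (redc (pi : R) (Cplx d') k),
      imgm (redc (pi : R) (Cplx d) 1) =i imgm (redc (pi : R) (Cplx d') 1)
    & forall (x : H0 (redc (pi : R) (Cplx d) k))
             (x' : H0 (redc (pi : R) (Cplx d') k)), val x = val x' ->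
      forall y : redmod (pi : R) (C1 S) 1,
        digit d k x = cls _ y <-> digit d' k x' = cls _ y].

Fact digit_image_killed d k (x : submodule (imgm (digit d k))) :
  (pi : R) *: x = 0.
Proof.
apply: val_inj => /=; have [u ->] := cls_surj (val x); have [v ->] := cls_surj u.
have e : (pi : R) *: cls (mults ((pi : R) ^+ 1) (C1 S)) v = 0.
  rewrite -linearZ /= -[0](linear0 (cls _)); apply/cls_eq/multsP; exists v.
  by rewrite subr0 expr1.
by rewrite -linearZ e linear0.
Qed.

Definition digit_image d k : lmodType (residue pi) :=
  resmod (@digit_image_killed d k).

Definition congruent_mod d d' n : Prop :=
  forall s, d s - d' s \in mults ((pi : R) ^+ n) (C1 S).

End Digits.

Section SmithAndBarcode.
Variables (R : dvrType) (pi : uniformizer R).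

Definition smith_mx n1 n0 (a : seq nat) : 'M[R]_(n1, n0) :=
  \matrix_(i < n1, j < n0)
    if ((i : nat) == j) && (i < size a)%N then (pi : R) ^+ nth 0%N a i else 0.

(* The isomorphisms f0 and f1 are coordinates in bases of M and N, and A is the
   matrix of d in these bases. *)
Definition smith_exponents (M N : lmodType R) (d : {linear M -> N})
    (a : seq nat) : Prop :=
  sorted leq a /\
  exists (n0 n1 : nat) (f0 : {linear M -> 'cV[R]_n0}) (f1 : {linear N -> 'cV[R]_n1})
    (A : 'M[R]_(n1, n0)) (U : 'M[R]_n1) (V : 'M[R]_n0),
  [/\ bijective f0 /\ bijective f1,
      forall x, f1 (d x) = A *m f0 x,
      U \in unitmx /\ V \in unitmx,
      (size a <= minn n0 n1)%N
    & U *m A *m V = smith_mx n1 n0 a].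

Definition is_barcode (M : lmodType R) (B : seq (interval nat)) : Prop :=
  exists (b : nat) (a : seq nat),
  [/\ all (leq 1) a,
      exists f : {linear M ->
        ('rV[R]_b * prodmod (fun j : 'I_(size a) =>
           redmod (pi : R) R^o (nth 0%N a j) : lmodType R))%type},
        bijective f
    & perm_eq B (nseq b `[0%N, +oo[ ++ [seq `[0%N, l[ | l <- a])].

End SmithAndBarcode.

Definition truncate_bars (m : nat) (B : seq (interval nat)) :
  seq (interval nat) := [seq Order.meet i `[0%N, m[ | i <- B].

(* Main.v *)
(* If d s = pi^k t, then the digit map sends [s] to [t]; replacing d by d' changes
   t by a multiple of pi^(m - k), which vanishes mod pi when k < m. For the same
   reason the kernel {x : pi^k x in pi^(k+1) C^1 + im d} of
   C^1 -> V_k, x |-> [pi^k x], is unchanged, whence the isomorphism of truncated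
   persistence modules. Both Smith exponents and bars present H^1 diagonally, and
   dim V_k is then the number of diagonal entries divisible by pi^(k+1), so the
   multiplicities of the lengths l < m are the differences
   dim V_(l-1) - dim V_l. *)
From HB Require Import structures.
Require Import Defs.
From mathcomp Require Import all_boot all_order all_algebra.
From mathcomp Require Import boolp zify.

Set Implicit Arguments.
Unset Strict Implicit.
Unset Printing Implicit Defensive.

Import Order.TTheory GRing.Theory.
Local Open Scope ring_scope.
Local Open Scope quotient_scope.

(** * Maps from an R-module that are linear along a surjection R -> F *)

Section Factorization.
Variables (R F : nzRingType) (sigma : R -> F) (X : lmodType R).
Variables (A B : lmodType F) (p : X -> A) (q : X -> B).
Hypothesis sigma_surj : forall a, exists r, a = sigma r.
Hypothesis p_lin : forall r x y, p (r *: x + y) = sigma r *: p x + p y.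
Hypothesis q_lin : forall r x y, q (r *: x + y) = sigma r *: q x + q y.
Hypothesis p_surj : forall a, exists x, a = p x.

(** The usual factorization through a surjection, for a source over R and targets over F: it turns
    constructions on R-modules into linear maps of residue spaces. *)
Lemma semilinear_factor : (forall x, p x = 0 -> q x = 0) ->
  exists phi : {linear A -> B}, forall x, phi (p x) = q x.
Proof.
move=> ker_pq.
(* Differences are formed in X with a lift of -1, the only link between [sigma] and opposites. *)
have [mone mone1] := sigma_surj (- 1).
have pq x y : p x = p y -> q x = q y.
  move=> pxy; have : p (mone *: y + x) = 0 by rewrite p_lin -mone1 scaleN1r pxy addNr.
  by move=> /ker_pq; rewrite q_lin -mone1 scaleN1r addrC => /eqP; rewrite subr_eq0 => /eqP.
pose phi a := q (projT1 (cid (p_surj a))).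
have phiE x : phi (p x) = q x by rewrite /phi; case: cid => y /= /esym; exact: pq.
have phi_lin : linear phi.
  move=> a u v; have [r ->] := sigma_surj a.
  by have [x ->] := p_surj u; have [y ->] := p_surj v; rewrite -p_lin !phiE q_lin.
pose Phi : {linear A -> B} := HB.pack phi (GRing.isLinear.Build F A B *:%R phi phi_lin).
by exists Phi.
Qed.

End Factorization.

Lemma linear_bijective (F : nzRingType) (A B : lmodType F) (f : {linear A -> B}) :
  (forall x, f x = 0 -> x = 0) -> (forall y, exists x, y = f x) -> bijective f.
Proof.
move=> f0 fs; pose g y := projT1 (cid (fs y)).
have gK : cancel g f by move=> y; rewrite /g; case: cid.
exists g => // x; apply/eqP; rewrite -subr_eq0; apply/eqP/f0.
by rewrite linearB /= gK subrr.
Qed.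

(** Two quotients of X with the same kernel are isomorphic. The digit images, the spaces V_k and
    their coordinate spaces are all compared in this way. *)
Lemma semilinear_iso (R F : nzRingType) (sigma : R -> F) (X : lmodType R)
    (A B : lmodType F) (p : X -> A) (q : X -> B) :
    (forall a, exists r, a = sigma r) ->
    (forall r x y, p (r *: x + y) = sigma r *: p x + p y) ->
    (forall r x y, q (r *: x + y) = sigma r *: q x + q y) ->
    (forall a, exists x, a = p x) -> (forall b, exists x, b = q x) ->
    (forall x, p x = 0 <-> q x = 0) ->
  exists2 phi : {linear A -> B}, bijective phi & forall x, phi (p x) = q x.
Proof.
move=> ss pl ql ps qs pq.
have [phi phiE] := semilinear_factor ss pl ql ps (fun x => (pq x).1).
exists phi => //; apply: linear_bijective => [a|b].
  by have [x ->] := ps a; rewrite phiE => /pq.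
by have [x ->] := qs b; exists (p x).
Qed.

(** * Dimension of vector spaces *)

Section Dimension.
Variable F : fieldType.
Implicit Types V W : lmodType F.

Lemma has_dim_iso V W (f : {linear V -> W}) n :
  bijective f -> has_dim W n -> has_dim V n.
Proof. by move=> bf [g bg]; exists (g \o f); exact: bij_comp. Qed.

(** One coordinate system followed by the inverse of the other is an injective map of row spaces,
    whose matrix has full row rank. *)
Lemma has_dim_leq V n n' : has_dim V n -> has_dim V n' -> (n <= n')%N.
Proof.
move=> [f bf] [g bg].
pose h : {linear 'rV[F]_n -> 'rV[F]_n'} := g \o linv bf.
have hinj : injective h.
  by apply: inj_comp; [exact: bij_inj bg | exact: can_inj (linvK bf)].
suff /eqP <- : row_free (lin1_mx h) by exact: rank_leq_col.
apply: inj_row_free => u; rewrite mul_rV_lin1 => hu.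
by apply: hinj; rewrite hu linear0.
Qed.

Lemma has_dim_unique V n n' : has_dim V n -> has_dim V n' -> n = n'.
Proof. by move=> h h'; apply/eqP; rewrite eqn_leq !(has_dim_leq h h', has_dim_leq h' h). Qed.

Lemma subquotient_has_dim N V W (q : {linear 'rV[F]_N -> W}) (i : {linear V -> W}) :
  (forall w, exists x, w = q x) -> injective i -> exists n, has_dim V n.
Proof.
move=> qs ii.
(* A maximal linearly independent family of V is a basis; preimages under q of
   independent vectors are independent, so its size is at most N. *)
pose comb n (v : 'I_n -> V) (c : 'rV[F]_n) := \sum_j c 0 j *: v j.
have comb_lin n v : linear (@comb n v).
  move=> a x y; rewrite /comb scaler_sumr -big_split /=; apply: eq_bigr => j _.
  by rewrite !mxE scalerDl scalerA.
pose indep n := `[< exists v : 'I_n -> V, forall c, comb n v c = 0 -> c = 0 >].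
have indep_le n : indep n -> (n <= N)%N.
  move=> /asboolP[v vfree]; pose A := \matrix_j projT1 (cid (qs (i (v j)))).
  suff /eqP <- : row_free A by exact: rank_leq_col.
  rewrite -kermx_eq0; apply/rowV0P => c /sub_kermxP cA; apply: vfree; apply: ii.
  rewrite linear0 -(linear0 q) -cA mulmx_sum_row !linear_sum; apply: eq_bigr => j _.
  by rewrite !linearZ /= rowK; case: cid => x /= ->.
have indep0 : exists n, indep n.
  by exists 0; apply/asboolP; exists (fun=> 0) => c _; apply/rowP; case.
have [n /asboolP[v vfree] n_max] := ex_maxnP indep0 indep_le.
exists n; pose f : {linear 'rV[F]_n -> V} :=
  HB.pack (comb n v) (GRing.isLinear.Build F _ _ *:%R (comb n v) (comb_lin n v)).
suff bf : bijective f.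
  exists (linv bf); have [g fK gK] := bf; exists f; first exact: linvK.
  by move=> x; apply: (bij_inj bf); rewrite linvK.
apply: linear_bijective => // w; apply: contrapT => w_out.
have /n_max : indep n.+1; last by rewrite ltnn.
(* [w] is put at index 0, before [v]. A nonzero coefficient of [w] would place it in the image of
   [f]; once that coefficient vanishes, independence of [v] kills the others. *)
apply/asboolP; exists (fun j => oapp v w (unlift ord0 j)) => c.
rewrite /comb big_ord_recl unlift_none /=.
under eq_bigr do rewrite liftK /=.
pose c' : 'rV[F]_n := \row_j c 0 (lift ord0 j).
have -> : \sum_(j < n) c 0 (lift ord0 j) *: v j = f c'.
  by apply: eq_bigr => j _; rewrite mxE.
move=> c0; have cw : c 0 ord0 *: w = - f c' by apply/eqP; rewrite -addr_eq0 c0.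
have c00 : c 0 ord0 = 0.
  apply/eqP; apply: contra_notT w_out => cN0; exists ((c 0 ord0)^-1 *: - c').
  by rewrite linearZ linearN /= -cw scalerA mulVf ?scale1r.
have /rowP c'0 : c' = 0.
  by apply: vfree; move: c0; rewrite c00 scale0r add0r.
apply/rowP => j; rewrite [RHS]mxE; case: (unliftP ord0 j) => [l|] -> //.
by have := c'0 l; rewrite !mxE.
Qed.
End Dimension.

Lemma cls_eq0 (R : comNzRingType) (M : lmodType R) (N : submodClosed M) (x : M) :
  cls N x = 0 <-> x \in N.
Proof. by rewrite -(linear0 (cls N)) cls_eq subr0. Qed.

(** * Elements of pi^k M / pi^(k+1) M *)

Section ValuationClasses.
Variables (R : dvrType) (pi : uniformizer R).
Implicit Types M : lmodType R.

Lemma residue_surj (a : residue pi) : exists r : R, a = \pi_(residue pi) r.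
Proof. by exists (repr a); rewrite reprK. Qed.

Lemma residue_eq0 (r : R) : \pi_(residue pi) r = 0 <-> exists y, r = (pi : R) * y.
Proof.
split=> [r0|[y ->]].
  have : r - 0 \in max_ideal pi by rewrite Quotient.idealrBE r0 rmorph0.
  by rewrite subr0 => /asboolP.
apply/eqP; rewrite -(rmorph0 \pi_(residue pi)) -Quotient.idealrBE subr0.
by apply/asboolP; exists y.
Qed.

(** Parametrizing V_k by M rather than by pi^k M makes every transition map the identity on
    representatives. *)
Definition gr_class M k (x : M) : vspace_at pi M k := cls _ (scale_into (pi : R) k x).

Lemma gr_class_semilinear M k r (x y : M) :
  gr_class k (r *: x + y) = \pi_(residue pi) r *: gr_class k x + gr_class k y.
Proof.
by rewrite /gr_class !linearP; congr (_ + _); rewrite [RHS]resmod_scaleE.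
Qed.

Lemma gr_class_surj M k (v : vspace_at pi M k) : exists x, v = gr_class k x.
Proof.
have [u ->] := cls_surj v; have /multsP[x xE] := valP u; exists x.
by congr cls; apply: val_inj.
Qed.

Lemma gr_class_eq0 M k (x : M) :
  gr_class k x = 0 <-> exists y, (pi : R) ^+ k *: x = (pi : R) ^+ k.+1 *: y.
Proof. by rewrite [X in X <-> _]cls_eq0 withinE; split=> /multsP. Qed.

Lemma gr_class_step M k (x : M) : vspace_step (gr_class k x) = gr_class k.+1 x.
Proof.
rewrite /vspace_step /gr_step /gr_class quotmapE; congr cls.
by apply: val_inj; rewrite /= scalerA -exprS.
Qed.

End ValuationClasses.

(** * Digit maps of congruent differentials *)

Section Congruence.
Variables (R : dvrType) (pi : uniformizer R) (G : graph) (S : stalks R G).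
Variables (d d' : {linear C0 S -> C1 S}) (m : nat).
Hypothesis dd' : congruent_mod pi d d' m.
Local Notation p := (pi : R).

Lemma congruent_modE s : exists y, d' s = d s + p ^+ m *: y.
Proof.
have /multsP[y yE] := dd' s; exists (- y).
by rewrite scalerN -yE opprB addrC subrK.
Qed.

Lemma congruent_redmap k : (k <= m)%N -> redmap p d k =1 redmap p d' k.
Proof.
move=> km x; have [s ->] := cls_surj x; rewrite !redmapE; apply/cls_eq.
have /multsP[y ->] := dd' s; apply/multsP; exists (p ^+ (m - k) *: y).
by rewrite scalerA -exprD subnKC.
Qed.

End Congruence.

Lemma congruent_mod_sym (R : dvrType) (pi : uniformizer R) (G : graph)
    (S : stalks R G) (d d' : {linear C0 S -> C1 S}) m :
  congruent_mod pi d d' m -> congruent_mod pi d' d m.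
Proof. by move=> dd' s; rewrite -opprB rpredN. Qed.

(** Since [x] |-> [pi^k x] is injective on H^1, it suffices to compute the connecting map; for that,
    [s] modulo pi^(k+1) is a lift of the cocycle and its differential is the class of pi^k t. *)
Lemma digit_ofE (R : comNzRingType) (pi : R) (K : cplx R) k pi_reg
    (x : H0 (redc pi K k)) (s : cplx0 K) (t : cplx1 K) :
  val x = cls _ s -> diff K s = pi ^+ k *: t ->
  @digit_of R pi K k pi_reg x = cls _ (cls _ t).
Proof.
move=> xs dst; have inj := bij_inj (@gr_shift_bij R pi K k pi_reg).
apply: inj.
transitivity (connecting (digit_sequence pi K k) x); first exact: linvK.
transitivity (cls (imgm (grc pi K k)) (cls _ (scale_into pi k t))).
  have E := @connectingE _ _ _ _ _ _ (digit_sequence pi K k) x (cls _ s)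
    (cls _ (scale_into pi k t)).
  apply: E.
    by rewrite xs; exact: red_projE.
  transitivity (cls (mults (pi ^+ k.+1) (cplx1 K)) (pi ^+ k *: t)).
    by rewrite -dst; exact: redmapE.
  exact/esym/gr_inclE.
by apply/esym; rewrite H1mapE; congr cls; exact: gr_shiftE.
Qed.

Section Digits.
Variables (R : dvrType) (pi : uniformizer R) (G : graph) (S : stalks R G).
Local Notation p := (pi : R).

Lemma digitE (d : {linear C0 S -> C1 S}) k (x : H0 (redc p (Cplx d) k))
    (s : C0 S) (t : C1 S) :
  val x = cls _ s -> d s = p ^+ k *: t -> digit pi d k x = cls _ (cls _ t).
Proof. exact: digit_ofE. Qed.

Lemma congruent_same_digit (d d' : {linear C0 S -> C1 S}) m k :
  congruent_mod pi d d' m -> (k < m)%N -> same_digit pi d d' k.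
Proof.
move=> dd' km.
have im1 : imgm (redc p (Cplx d) 1) =i imgm (redc p (Cplx d') 1).
  have E := congruent_redmap dd' (leq_ltn_trans (leq0n k) km).
  move=> y; apply/imgmP/imgmP => -[x ->]; exists x; [exact: E|exact/esym/E].
split=> // [x|x x' xx' y].
  by rewrite !kermE /= (congruent_redmap dd' (ltnW km)).
have [s xs] := cls_surj (val x).
(* A cocycle modulo pi^k is the class of some [s] with [d s] in pi^k C^1. *)
have /eqP := valP x; rewrite xs.
rewrite [diff _ _]redmapE => /cls_eq0 /multsP[t dst].
have [u d's] := congruent_modE dd' s.
have d'st : d' s = p ^+ k *: (t + p ^+ (m - k) *: u).
  by rewrite d's dst scalerDr scalerA -exprD subnKC// ltnW.
rewrite (digitE xs dst) (@digitE d' _ x' s _ (etrans (esym xx') xs) d'st).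
(* The correction has a factor pi left because k < m is strict. *)
have -> : cls (mults (p ^+ 1) (C1 S)) (t + p ^+ (m - k) *: u) = cls _ t.
  apply/cls_eq/multsP; exists (p ^+ (m - k.+1) *: u).
  by rewrite addrC addKr scalerA -exprD add1n subnSK.
(* The two H^1's are distinct types, so both equations are read as memberships in the images
   identified by [im1]. *)
split=> /cls_eq H; apply/cls_eq; [rewrite -im1|rewrite im1]; exact: H.
Qed.

End Digits.

(** * Truncated valuation persistence modules *)

Section TruncatedModules.
Variables (R : dvrType) (pi : uniformizer R) (G : graph) (S : stalks R G).
Implicit Types d : {linear C0 S -> C1 S}.
Local Notation p := (pi : R).

(** Vanishing in V_k is lifted to a relation between cochains, where the two differentials can be
    compared. *)
Lemma gr_class_H1_eq0 d k (x : C1 S) :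
  gr_class pi k (cls (imgm d) x) = 0 <->
  exists w s, p ^+ k *: x = p ^+ k.+1 *: w + d s.
Proof.
rewrite gr_class_eq0; split=> [[y]|[w [s xE]]].
  have [w ->] := cls_surj y; rewrite -!linearZ /= => /cls_eq /imgmP[s sE].
  by exists w, s; rewrite -sE addrC subrK.
exists (cls _ w); rewrite -!linearZ /=; apply/cls_eq/imgmP; exists s.
by rewrite xE addrAC subrr add0r.
Qed.

Lemma congruent_gr_class_eq0 d d' m k (x : C1 S) :
  congruent_mod pi d d' m -> (k < m)%N ->
  gr_class pi k (cls (imgm d) x) = 0 -> gr_class pi k (cls (imgm d') x) = 0.
Proof.
move=> dd' km /gr_class_H1_eq0[w [s xE]]; apply/gr_class_H1_eq0.
have [y ds] := congruent_modE (congruent_mod_sym dd') s.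
(* The difference between [d s] and [d' s] is a multiple of pi^m, hence of pi^(k+1), and is absorbed
   into [w]. *)
exists (w + p ^+ (m - k.+1) *: y), s.
by rewrite xE ds scalerDr scalerA -exprD subnKC// -addrA [_ + d' s]addrC.
Qed.

Lemma congruent_trunc_iso d d' m : congruent_mod pi d d' m ->
  trunc_iso m (valuation_persmod pi (H1 (Cplx d)))
              (valuation_persmod pi (H1 (Cplx d'))).
Proof.
move=> dd'.
pose q (e : {linear C0 S -> C1 S}) k (x : C1 S) :
  vspace_at pi (H1 (Cplx e)) k := gr_class pi k (cls (imgm e) x).
have q_lin e k (r : R) x y : q e k (r *: x + y) = \pi_(residue pi) r *: q e k x + q e k y.
  by rewrite -gr_class_semilinear -linearP.
have q_surj e k a : exists x, a = q e k x.
  have [y ->] := gr_class_surj a; have [x ->] := cls_surj y; by exists x.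
have E k : exists phi : {linear vspace_at pi (H1 (Cplx d)) k ->
                                vspace_at pi (H1 (Cplx d')) k},
    (k < m)%N -> bijective phi /\ forall x, phi (q d k x) = q d' k x.
  (* The family must be defined at every k; from m on the zero map serves. *)
  have [km|mk] := ltnP k m; last by exists \0.
  have q0 x : q d k x = 0 <-> q d' k x = 0.
    split; apply: congruent_gr_class_eq0 km => //; exact: congruent_mod_sym.
  have [phi phi_bij phiE] := semilinear_iso (@residue_surj R pi) (q_lin d k)
    (q_lin d' k) (q_surj d k) (q_surj d' k) q0.
  by exists phi.
pose phi k := projT1 (cid (E k)).
have phiP k : (k < m)%N -> bijective (phi k) /\ forall x, phi k (q d k x) = q d' k x.
  exact: projT2 (cid (E k)).
exists phi; split=> [k /phiP[]//|k km x].
have [_ phiS] := phiP _ km; have [_ phik] := phiP _ (ltnW km).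
have [y xE] := q_surj d k x.
(* Both transition maps keep the cochain [y] and only raise k, so each side of the square is the
   class of [y] for d' at k + 1. *)
have step e : vspace_step (q e k y) = q e k.+1 y by exact: gr_class_step.
transitivity (phi k.+1 (q d k.+1 y)).
  by congr (phi k.+1 _); rewrite xE; exact: step.
rewrite phiS -step; congr vspace_step.
by rewrite xE; exact: esym (phik y).
Qed.

End TruncatedModules.

(** * Dimension of the digit images *)

Section DigitDimension.
Variables (R : dvrType) (pi : uniformizer R) (G : graph) (S : stalks R G).
Implicit Types d : {linear C0 S -> C1 S}.
Local Notation p := (pi : R).
Import VectorInternalTheory.

(** The coordinates of all edge stalks are gathered in one row, indexed by an edge together with a
    basis index of its stalk. This bounds the dimension of H^1 modulo pi. *)
Lemma C1_finitely_generated :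
  exists N (f : {linear 'rV[R]_N -> C1 S}), forall y, exists x, y = f x.
Proof.
pose T := {e : edge G & 'I_(dim (estalk S e))}.
pose f (v : 'rV[R]_#|{: T}|) : C1 S := prodmod_of (fun e : edge G =>
  r2v (\row_j v 0 (enum_rank (Tagged (fun e => 'I_(dim (estalk S e))) j))) : estalk S e).
have f_lin : linear f.
  move=> a u v; apply/ffunP => e; rewrite prodmodDE prodmodZE !ffunE -linearP.
  by congr r2v; apply/rowP => j; rewrite !mxE.
pose fL : {linear 'rV[R]_#|{: T}| -> C1 S} :=
  HB.pack f (GRing.isLinear.Build R _ _ *:%R f f_lin).
exists #|{: T}|, fL => y.
exists (\row_i v2r (y (tag (enum_val i))) 0 (tagged (enum_val i))).
apply/ffunP => e; rewrite ffunE; apply: v2r_inj; rewrite r2vK.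
by apply/rowP => j; rewrite !mxE enum_rankK.
Qed.

Definition digit_value d k (x : H0 (redc p (Cplx d) k)) : digit_image pi d k :=
  Sub (digit pi d k x) (introT (imgmP _ _) (ex_intro _ x erefl)).

Lemma digit_value_semilinear d k r (x y : H0 (redc p (Cplx d) k)) :
  digit_value (r *: x + y) =
  \pi_(residue pi) r *: digit_value x + digit_value y.
Proof.
have -> : \pi_(residue pi) r *: digit_value x =
  r *: (digit_value x : submodule (imgm (digit pi d k))) by exact: resmod_scaleE.
apply: val_inj; exact: linearP.
Qed.

(** Zero is written as a class because [same_digit] compares values only through representatives. *)
Lemma digit_value_eq0 d k (x : H0 (redc p (Cplx d) k)) :
  digit_value x = 0 <-> digit pi d k x = cls _ 0.
Proof.
rewrite (linear0 (cls _)); split=> [/(congr1 val)//|x0].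
apply: val_inj; exact: x0.
Qed.

Lemma digit_value_surj d k (v : digit_image pi d k) : exists x, v = digit_value x.
Proof.
have /imgmP[x xE] := valP (v : submodule (imgm (digit pi d k))).
by exists x; apply: val_inj.
Qed.

Lemma H1_mod_killed d (x : H1 (redc p (Cplx d) 1)) : p *: x = 0.
Proof.
have [u ->] := cls_surj x; have [v ->] := cls_surj u.
rewrite -!linearZ /= -(linear0 (cls _)); congr cls.
by apply/cls_eq0/multsP; exists v; rewrite expr1.
Qed.

(** H^1 modulo pi is a quotient of F^N, where N generators span C^1, and the digit image is a
    subspace of it. *)
Lemma digit_image_has_dim d k : exists n, has_dim (digit_image pi d k) n.
Proof.
pose W : lmodType (residue pi) := resmod (@H1_mod_killed d).
have [N [f f_surj]] := C1_finitely_generated.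
pose q (v : 'rV[R]_N) : W := cls _ (cls _ (f v)).
have q_lin r x y : q (r *: x + y) = \pi_(residue pi) r *: q x + q y.
  have -> : \pi_(residue pi) r *: q x = r *: (q x : H1 (redc p (Cplx d) 1)).
    exact: resmod_scaleE.
  rewrite /q; have -> : f (r *: x + y) = r *: f x + f y by exact: linearP.
  transitivity (cls (imgm (redc p (Cplx d) 1)) (r *: cls _ (f x) + cls _ (f y))).
    by congr cls; exact: linearP.
  exact: linearP.
pose red (v : 'rV[R]_N) : 'rV[residue pi]_N := \row_j \pi_(residue pi) (v 0 j).
have red_lin r x y : red (r *: x + y) = \pi_(residue pi) r *: red x + red y.
  by apply/rowP => j; rewrite !mxE rmorphD rmorphM.
have red_surj a : exists x, a = red x.
  by exists (\row_j repr (a 0 j)); apply/rowP => j; rewrite !mxE reprK.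
(* If all coordinates of [x] are divisible by pi, then so is [f x], which therefore dies modulo
   pi. *)
have red_q x : red x = 0 -> q x = 0.
  move=> /rowP x0; have xj j : exists y, x 0 j = p * y.
    by apply/residue_eq0; have := x0 j; rewrite !mxE.
  have [z xz] : exists z, x = p *: z.
    exists (\row_j projT1 (cid (xj j))).
    by apply/rowP => j; rewrite !mxE; case: cid.
  have fx0 : cls (mults (p ^+ 1) (C1 S)) (f x) = 0.
    by apply/cls_eq0/multsP; exists (f z); rewrite xz expr1; exact: linearZ.
  by rewrite /q fx0; exact: linear0.
have [phi phiE] := semilinear_factor (@residue_surj R pi) red_lin q_lin red_surj red_q.
pose i (x : digit_image pi d k) : W := val (x : submodule (imgm (digit pi d k))).
have i_lin : linear i.
  move=> a x y; have [r ->] := residue_surj a.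
  have -> : \pi_(residue pi) r *: x =
    r *: (x : submodule (imgm (digit pi d k))) by exact: resmod_scaleE.
  have -> : \pi_(residue pi) r *: i x = r *: (i x : H1 (redc p (Cplx d) 1)).
    exact: resmod_scaleE.
  exact: (linearP (val : {linear submodule (imgm (digit pi d k)) -> _})).
pose iL : {linear digit_image pi d k -> W} :=
  HB.pack i (GRing.isLinear.Build _ _ _ *:%R i i_lin).
apply: (@subquotient_has_dim _ N _ W phi iL); last by move=> x y /val_inj.
move=> w; have [u ->] := cls_surj w; have [v ->] := cls_surj u.
by have [x ->] := f_surj v; exists (red x); exact: esym (phiE x).
Qed.

(** Both images are quotients of the H^0 of d', the image for d by way of the transport [c]; the
    kernels agree by [same_digit] at the representative 0. *)
Lemma same_digit_has_dim d d' k n : same_digit pi d d' k ->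
  has_dim (digit_image pi d k) n -> has_dim (digit_image pi d' k) n.
Proof.
move=> [ker_eq _ digit_eq] d_dim.
have cast_ker (x : H0 (redc p (Cplx d') k)) : val x \in kerm (redc p (Cplx d) k).
  by rewrite ker_eq; exact: (valP x).
pose c (x : H0 (redc p (Cplx d') k)) : H0 (redc p (Cplx d) k) := Sub (val x) (cast_ker x).
have c_lin : linear c by move=> r x y; exact: val_inj.
have q_lin r x y : digit_value (c (r *: x + y)) =
    \pi_(residue pi) r *: digit_value (c x) + digit_value (c y).
  by rewrite c_lin digit_value_semilinear.
have q_surj v : exists x, v = digit_value (c x).
  have [y ->] := digit_value_surj v.
  have y_ker : val y \in kerm (redc p (Cplx d') k) by rewrite -ker_eq; exact: (valP y).
  exists (Sub (val y) y_ker).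
  have -> : c (Sub (val y) y_ker) = y by exact: val_inj.
  by [].
have value_eq0 (x : H0 (redc p (Cplx d') k)) : digit_value x = 0 <-> digit_value (c x) = 0.
  rewrite !digit_value_eq0; exact: iff_sym (digit_eq (c x) x erefl 0).
have [phi phi_bij _] := semilinear_iso (@residue_surj R pi)
  (@digit_value_semilinear d' k) q_lin (@digit_value_surj d' k) q_surj value_eq0.
exact: has_dim_iso phi_bij d_dim.
Qed.

End DigitDimension.

(** * Diagonal presentations and the dimension of V_k *)

Section DiagonalPresentation.
Variables (R : dvrType) (pi : uniformizer R).
Local Notation p := (pi : R).

(* g presents M as the sum of the R / c_i, and D selects the summands whose k-th
   graded piece is nonzero. *)
Lemma diagonal_gr_has_dim (M : lmodType R) (I : finType) (c : I -> R)
    (g : {linear {ffun I -> R^o} -> M}) k (D : pred I) :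
  (forall y, exists x, y = g x) ->
  (forall x, g x = 0 <-> forall i, exists y : R, x i = c i * y) ->
  (forall i, D i -> exists y : R, c i = p ^+ k.+1 * y) ->
  (forall i, ~~ D i -> exists y : R, p ^+ k = c i * y) ->
  has_dim (vspace_at pi M k) #|D|.
Proof.
move=> g_surj g_ker c_large c_small.
pose A (x : {ffun I -> R^o}) : vspace_at pi M k := gr_class pi k (g x).
have A_lin r x y : A (r *: x + y) = \pi_(residue pi) r *: A x + A y.
  by rewrite -gr_class_semilinear -linearP.
have A_surj a : exists x, a = A x.
  have [y ->] := gr_class_surj a; have [x ->] := g_surj y; by exists x.
pose B (x : {ffun I -> R^o}) : 'rV[residue pi]_#|D| :=
  \row_j \pi_(residue pi) (x (enum_val j) : R).
have B_lin r x y : B (r *: x + y) = \pi_(residue pi) r *: B x + B y.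
  by apply/rowP => j; rewrite !mxE !ffunE rmorphD rmorphM.
have B_surj b : exists x, b = B x.
  (* The test is reflected because [enum_rank_in] requires a proof of [D i]; coordinates outside [D]
     are set to 0. *)
  exists [ffun i => (if D i =P true is ReflectT Di
    then repr (b 0 (enum_rank_in Di i)) else 0) : R^o].
  apply/rowP => j; rewrite !mxE ffunE; case: eqP => [Di|]; last first.
    by have := enum_valP j; rewrite unfold_in => ->.
  by rewrite enum_valK_in reprK.
(* The class of [x] vanishes in V_k exactly when pi divides its coordinates in [D]. *)
have AB x : A x = 0 <-> B x = 0.
  rewrite gr_class_eq0; split=> [[y0 xy0]|/rowP x0].
    have [y yE] := g_surj y0; apply/rowP => j; rewrite !mxE; apply/residue_eq0.
    have /g_ker/(_ (enum_val j))[z] : g (p ^+ k *: x - p ^+ k.+1 *: y) = 0.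
      by rewrite linearB linearZ [g (_ *: y)]linearZ /= -yE xy0 subrr.
    have /c_large[w ->] : D (enum_val j) by have := enum_valP j; rewrite unfold_in.
    rewrite !ffunE /=.
    (* Every term other than pi^k x_i is a multiple of pi^(k+1), so cancelling pi^k leaves x_i
       divisible by pi. *)
    move=> /eqP; rewrite subr_eq => /eqP; rewrite -mulrA -mulrDr exprSr -mulrA.
    move=> /mulfI -> //; last exact: expf_neq0 (uniformizer_neq0 pi).
    by eexists.
  (* Outside [D], c_i divides pi^k and y = 0 works; inside, pi divides x_i and z = 0 works. *)
  have xy i : exists y z : R, p ^+ k * x i = p ^+ k.+1 * y + c i * z.
    have [Di|/c_small[z ->]] := boolP (D i); last first.
      by exists 0, (z * x i); rewrite mulr0 add0r mulrA.
    have := x0 (enum_rank_in Di i); rewrite !mxE enum_rankK_in//.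
    move=> /residue_eq0[y ->]; exists y, 0.
    by rewrite mulr0 addr0 exprSr mulrA.
  pose y i := projT1 (cid (xy i)).
  have yP i : exists z, p ^+ k * x i = p ^+ k.+1 * y i + c i * z.
    by rewrite /y; case: cid.
  exists (g [ffun i => y i : R^o]); rewrite -!linearZ /=.
  apply/eqP; rewrite -subr_eq0 -linearB; apply/eqP/g_ker => i.
  have [z xE] := yP i; exists z; rewrite !ffunE.
  by rewrite [_ *: _]xE addrAC subrr add0r.
have [phi phi_bij _] := semilinear_iso (@residue_surj R pi) A_lin B_lin A_surj B_surj AB.
by exists phi.
Qed.

End DiagonalPresentation.

Lemma card_ord_nth (a : seq nat) (P : pred nat) n : (size a <= n)%N ->
  #|[pred i : 'I_n | (i < size a)%N && P (nth 0%N a i)]| = count P a.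
Proof.
move=> an; rewrite -sum1_count (big_nth 0) big_mkord -sum1_card.
rewrite (big_ord_widen_cond _ (fun i => P (nth 0%N a i)) (fun=> 1) an).
by apply: eq_bigl => i; rewrite inE andbC.
Qed.

Section Presentations.
Variables (R : dvrType) (pi : uniformizer R).
Local Notation p := (pi : R).

(** Each of the n rows of the Smith matrix gives a summand R / c_i, with c_i = 0 past the rank; it
    contributes to V_k unless its exponent is at most k. The bound on [size a] keeps the subtraction
    exact. *)
Lemma smith_gr_has_dim (M N : lmodType R) (d : {linear M -> N}) a :
  smith_exponents pi d a -> exists2 n, (size a <= n)%N &
  forall k, has_dim (vspace_at pi (H1 (Cplx d)) k) (n - count (geq k) a).
Proof.
move=> [_ [n0 [n1 [f0 [f1 [A [U [V [[f0_bij f1_bij] f1d [Uu Vu] a_size UAV]]]]]]]]].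
move: a_size; rewrite leq_min => /andP[a_n0 a_n1].
exists n1 => // k.
pose c (i : 'I_n1) : R := if (i < size a)%N then p ^+ nth 0%N a i else 0.
pose col (x : {ffun 'I_n1 -> R^o}) : 'cV[R]_n1 := \col_i (x i : R).
pose g (x : {ffun 'I_n1 -> R^o}) : H1 (Cplx d) :=
  cls (imgm d) (linv f1_bij (invmx U *m col x)).
have g_lin : linear g.
  move=> r x y; rewrite /g; have -> : col (r *: x + y) = r *: col x + col y.
    by apply/colP => i; rewrite !mxE !ffunE.
  by rewrite mulmxDr -scalemxAr !linearP.
pose gL : {linear {ffun 'I_n1 -> R^o} -> H1 (Cplx d)} :=
  HB.pack g (GRing.isLinear.Build _ _ _ *:%R g g_lin).
pose small := [pred i : 'I_n1 | (i < size a)%N && geq k (nth 0%N a i)].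
pose D : pred 'I_n1 := [predC small].
have -> : (n1 - count (geq k) a)%N = #|D|.
  have D_card : (count (geq k) a + #|D| = n1)%N.
    by rewrite -(card_ord_nth (geq k) a_n1) (cardC small) card_ord.
  by rewrite -[X in (X - _)%N]D_card addKn.
apply: (@diagonal_gr_has_dim _ _ _ _ c gL).
- move=> y; have [z ->] := cls_surj y.
  exists [ffun i => (U *m f1 z) i 0 : R^o]; rewrite /= /g; congr cls.
  have -> : col [ffun i => (U *m f1 z) i 0 : R^o] = U *m f1 z.
    by apply/colP => i; rewrite !mxE !ffunE mxE.
  by rewrite mulKmx//; apply: (bij_inj f1_bij); rewrite linvK.
- move=> x; rewrite [gL x]/(g x) /g cls_eq0.
  (* In the coordinates given by [U], the image of d is the column space of the Smith matrix, as [V]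
     is invertible. *)
  have -> : linv f1_bij (invmx U *m col x) \in imgm d <->
      exists w, col x = smith_mx pi n1 n0 a *m w.
    split=> [/imgmP[y yE]|[w xw]].
      exists (invmx V *m f0 y); rewrite -UAV -!mulmxA mulKVmx// -f1d -yE linvK.
      by rewrite mulKVmx.
    have [h hK Kh] := f0_bij; apply/imgmP; exists (h (V *m w)).
    by apply: (bij_inj f1_bij); rewrite linvK f1d Kh xw -UAV -!mulmxA mulKmx.
  split=> [[w /colP xw] i|xc].
    have := xw i; rewrite !mxE => ->; rewrite /c.
    case: ltnP => ia; last first.
      exists 0; rewrite mulr0 big1// => j _; rewrite mxE ltnNge ia andbF mul0r//.
    exists (w (Ordinal (leq_trans ia a_n0)) 0).
    rewrite (bigD1 (Ordinal (leq_trans ia a_n0)))//= big1 ?addr0.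
      by rewrite mxE eqxx ia.
    move=> j; rewrite -val_eqE /= eq_sym => /negPf ji.
    by rewrite mxE ji mul0r.
  pose y i := projT1 (cid (xc i)).
  have yE i : x i = c i * y i by rewrite /y; case: cid.
  (* The quotients y_j are indexed by rows and the solution by columns; columns with no matching row
     receive 0. *)
  exists (\col_j oapp y 0 (insub (val j))).
  apply/colP => i; rewrite !mxE yE /c.
  case: ltnP => ia; last first.
    by rewrite mul0r big1// => j _; rewrite mxE ltnNge ia andbF mul0r.
  rewrite (bigD1 (Ordinal (leq_trans ia a_n0)))//= big1 ?addr0.
    rewrite !mxE eqxx ia /= insubT //= => i_n1; congr (_ * y _); exact: val_inj.
  move=> j; rewrite -val_eqE /= eq_sym => /negPf ji.
  by rewrite !mxE ji mul0r.
- move=> i; rewrite /D inE /= /c; case: ltnP => /= ia.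
    move=> ki; have {}ki : (k < nth 0%N a i)%N by move: ki; rewrite inE ia /= -ltnNge.
    by exists (p ^+ (nth 0%N a i - k.+1)); rewrite -exprD subnKC.
  by move=> _; exists 0; rewrite mulr0.
- move=> i; rewrite /D /= negbK inE => /andP[ia ik]; rewrite /c ia.
  by exists (p ^+ (k - nth 0%N a i)); rewrite -exprD subnKC.
Qed.

(** A free summand is R / 0 and contributes to every V_k; R / pi^l contributes exactly when k <
    l. *)
Lemma barcode_gr_has_dim (M : lmodType R) b (a : seq nat) k
    (f : {linear M -> ('rV[R]_b * prodmod (fun j : 'I_(size a) =>
           redmod (pi : R) R^o (nth 0%N a j) : lmodType R))%type}) :
  bijective f -> has_dim (vspace_at pi M k) (b + count (ltn k) a).
Proof.
move=> f_bij.
pose I : finType := ('I_b + 'I_(size a))%type.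
pose c (i : I) : R := if i is inr j then p ^+ nth 0%N a j else 0.
pose h (x : {ffun I -> R^o}) :=
  (\row_i (x (inl i) : R), prodmod_of (fun j : 'I_(size a) =>
     cls (mults (p ^+ nth 0%N a j) R^o) (x (inr j)) : redmod p R^o (nth 0%N a j))).
have h_lin r x y : h (r *: x + y) = r *: h x + h y.
  congr pair; first by apply/rowP => i; rewrite !mxE !ffunE.
  by apply/ffunP => j; rewrite prodmodDE prodmodZE !ffunE linearP.
pose g (x : {ffun I -> R^o}) : M := linv f_bij (h x).
have g_lin : linear g.
  by move=> r x y; rewrite /g h_lin linearP.
pose gL : {linear {ffun I -> R^o} -> M} :=
  HB.pack g (GRing.isLinear.Build _ _ _ *:%R g g_lin).
pose D : pred I := fun i => if i is inr j then (k < nth 0%N a j)%N else true.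
have -> : (b + count (ltn k) a)%N = #|D|.
  rewrite -(card_ord_nth (ltn k) (leqnn _)) -sum1_card big_sumType /= !sum1_card.
  by congr (_ + _)%N; [rewrite cardT size_enum_ord | apply: eq_card => i; rewrite inE ltn_ord].
apply: (@diagonal_gr_has_dim _ _ _ _ c gL).
- move=> y; exists [ffun i => match i with
    | inl i => (f y).1 0 i : R^o | inr j => repr ((f y).2 j) end].
  apply: (bij_inj f_bij); rewrite [gL _]/(g _) /g linvK.
  rewrite [LHS]surjective_pairing; congr pair.
    by apply/rowP => i; rewrite !mxE ffunE.
  by apply/ffunP => j; rewrite !ffunE cls_repr.
- move=> x; split=> [gx0|xc].
    have hx0 : h x = 0 by rewrite -(linear0 f) -gx0; exact/esym/linvK.
    case=> [i|j] /=.
      exists 0; rewrite mulr0.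
      by have /(congr1 fst)/rowP/(_ i) := hx0; rewrite !mxE.
    have /cls_eq0/multsP[y yE] : cls (mults (p ^+ nth 0%N a j) R^o) (x (inr j)) = 0.
      by have /(congr1 snd)/ffunP/(_ j) := hx0; rewrite !ffunE.
    by exists y.
  apply: (bij_inj f_bij); rewrite [gL _]/(g _) /g linvK linear0.
  congr pair.
    by apply/rowP => i; have [y] := xc (inl i); rewrite !mxE mul0r.
  apply/ffunP => j; rewrite !ffunE; apply/cls_eq0/multsP.
  by have [y] := xc (inr j); exists y.
- move=> [i|j] /=; first by exists 0; rewrite mulr0.
  by move=> kj; exists (p ^+ (nth 0%N a j - k.+1)); rewrite -exprD subnKC.
- move=> [//|j] /=; rewrite -leqNgt => jk.
  by exists (p ^+ (k - nth 0%N a j)); rewrite -exprD subnKC.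
Qed.

End Presentations.

(** * Counting exponents and truncated bars *)

Lemma count_geqS l (a : seq nat) :
  count (geq l.+1) a = (count (geq l) a + count_mem l.+1 a)%N.
Proof. by elim: a => //= x a ->; lia. Qed.

Lemma count_ltnS l (a : seq nat) :
  count (ltn l) a = (count (ltn l.+1) a + count_mem l.+1 a)%N.
Proof. by elim: a => //= x a ->; lia. Qed.

(** All bars start at 0, so truncation acts on lengths alone: infinite bars get length m, and finite
    ones the minimum of m and their length. *)
Lemma truncate_barsE m b (a : seq nat) (B : seq (interval nat)) :
  perm_eq B (nseq b `[0%N, +oo[ ++ [seq `[0%N, l[ | l <- a]) ->
  perm_eq (truncate_bars m B) [seq `[0%N, l[ | l <- nseq b m ++ map (minn m) a].
Proof.
move=> /(perm_map (fun i => Order.meet i `[0%N, m[)) /perm_trans; apply.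
rewrite !map_cat !map_nseq -!map_comp; apply/permP => P; congr (count _ (_ ++ _)).
apply: eq_map => l; rewrite /= {1}/Order.meet /= joinxx; congr Interval.
have [ml|/ltnW lm] := leqP m l; first by rewrite /= meet_r.
by rewrite /= meet_l.
Qed.

(** Below m, multiplicities are differences of consecutive counts. Infinite bars and bars of length
    at least m are merged at m, where only their total matters; [b] and [b'] may differ. *)
Lemma perm_truncated m b b' (a a' : seq nat) : (0 < m)%N ->
  all (leq 1) a -> all (leq 1) a' ->
  (forall k, (k < m)%N -> b + count (ltn k) a = b' + count (ltn k) a')%N ->
  perm_eq (nseq b m ++ map (minn m) a) (nseq b' m ++ map (minn m) a').
Proof.
move=> m_gt0 a_gt0 a'_gt0 count_eq.
have count_lt c (s : seq nat) l : (l < m)%N ->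
    count_mem l (nseq c m ++ map (minn m) s) = count_mem l s.
  move=> lm; rewrite count_cat count_nseq count_map /= gtn_eqF// mul0n.
  by apply: eq_count => x /=; lia.
(* Lengths at least m are those exceeding m - 1, so this is the count at k = m - 1. *)
have count_m c (s : seq nat) :
    count_mem m (nseq c m ++ map (minn m) s) = (c + count (ltn m.-1) s)%N.
  rewrite count_cat count_nseq count_map /= eqxx mul1n; congr addn.
  by apply: eq_count => x /=; lia.
have count_gt c (s : seq nat) l : (m < l)%N ->
    count_mem l (nseq c m ++ map (minn m) s) = 0%N.
  move=> ml; rewrite count_cat count_nseq count_map /= ltn_eqF// mul0n.
  by apply/eqP; rewrite -leqn0 leqNgt -has_count; apply/hasPn => x _ /=; lia.
apply/allP => l _; apply/eqP.
have [lm|ml|->] := ltngtP l m; first 1 last.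
- by rewrite !count_gt.
- by rewrite !count_m; apply: count_eq; rewrite prednK.
rewrite !count_lt//; case: l lm => [_|l lm].
  by rewrite !(count_memPn _)//; apply/negP; [move/(allP a'_gt0)|move/(allP a_gt0)].
have := count_eq _ (ltnW lm); have := count_eq _ lm.
by rewrite !(count_ltnS l); lia.
Qed.

Theorem theoremC (R : dvrType) (pi : uniformizer R) (G : graph)
    (S : stalks R G) (F F' : restrictions S) (m : nat) :
  let d := coboundary F in
  let d' := coboundary F' in
  (1 <= m)%N ->
  congruent_mod pi d d' m ->
  [/\ forall k, (k < m)%N -> same_digit pi d d' k,
      forall k, (k < m)%N -> exists n,
        has_dim (digit_image pi d k) n /\ has_dim (digit_image pi d' k) n,
      forall a a' : seq nat,
        smith_exponents pi d a -> smith_exponents pi d' a' ->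
        forall l, (1 <= l < m)%N -> count_mem l a = count_mem l a',
      forall B B' : seq (interval nat),
        is_barcode pi (H1 (Cplx d)) B -> is_barcode pi (H1 (Cplx d')) B' ->
        perm_eq (truncate_bars m B) (truncate_bars m B')
    & trunc_iso m (valuation_persmod pi (H1 (Cplx d)))
                  (valuation_persmod pi (H1 (Cplx d')))].
Proof.
move=> d d' m_gt0 dd'.
have same k : (k < m)%N -> same_digit pi d d' k by exact: congruent_same_digit.
have iso := congruent_trunc_iso dd'.
(* Both multiplicity statements are drawn from the equality of the dimensions of V_k for k < m. *)
have dim_eq k n n' : (k < m)%N -> has_dim (vspace_at pi (H1 (Cplx d)) k) n ->
    has_dim (vspace_at pi (H1 (Cplx d')) k) n' -> n = n'.
  have [phi [phi_bij _]] := iso.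
  by move=> km dim_n /(has_dim_iso (phi_bij k km)); exact: has_dim_unique.
split=> // [k km|a a' smith_a smith_a' [//|l] /andP[_ lm]|B B'].
- have [n dim_n] := digit_image_has_dim pi d k.
  by exists n; split=> //; exact: same_digit_has_dim (same k km) dim_n.
- have [n an dim_n] := smith_gr_has_dim smith_a.
  have [n' an' dim_n'] := smith_gr_has_dim smith_a'.
  have := dim_eq _ _ _ lm (dim_n _) (dim_n' _).
  have := dim_eq _ _ _ (ltnW lm) (dim_n _) (dim_n' _).
  (* The ranks [n] and [n'] cancel between the dimensions at l and l + 1; these bounds make the
     natural-number subtractions exact. *)
  have := leq_trans (count_size (geq l.+1) a) an.
  have := leq_trans (count_size (geq l.+1) a') an'.
  by rewrite !count_geqS; lia.
- move=> [b [a [a_gt0 [f f_bij] /(truncate_barsE m) BE]]].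
  move=> [b' [a' [a'_gt0 [f' f'_bij] /(truncate_barsE m) B'E]]].
  apply: perm_trans BE _; rewrite perm_sym; apply: perm_trans B'E _.
  rewrite perm_sym; apply/perm_map/perm_truncated => // k km.
  exact: dim_eq km (barcode_gr_has_dim k f_bij) (barcode_gr_has_dim k f'_bij).
Qed.
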